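(* Assume that $(\Omega,\mathcal F_t,\mathrm P|_{\mathcal F_t})$ is atomless for every $t>0$, that $Y^*\in\mathcal L^1(\mathcal Q)$, and that $\sup_{\mathrm Q\in\mathcal Q}\mathbb E_{\mathrm Q}[Y^*\mathbb 1_{\{Y^*>a\}}]\to 0$ as $a\to\infty$. Suppose that the range $\{\mu_{\mathcal Q}(A)\mid A\in\mathcal F\}$ of the vector measure $\mu_{\mathcal Q}$ is relatively compact in $(l^\infty(\mathcal Q),\|\cdot\|_\infty)$. Then $$\sup_{\tau\in\mathcal T}\inf_{\mathrm Q\in\mathcal Q}\mathbb E_{\mathrm Q}[Y_\tau]=\sup_{\tau\in\mathcal T}\inf_{\mathrm Q\in co(\mathcal Q)}\mathbb E_{\mathrm Q}[Y_\tau]=\inf_{\mathrm Q\in co(\mathcal Q)}\sup_{\tau\in\mathcal T}\mathbb E_{\mathrm Q}[Y_\tau].$$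
   Context: Let $0<T<\infty$ and let $(\Omega,\mathcal F,(\mathcal F_t)_{0\le t\le T},\mathrm P)$ be a filtered probability space with right-continuous filtration, $\mathcal F=\mathcal F_T$, and $\mathcal F_0$ containing only sets of probability $0$ or $1$ as well as all $\mathrm P$-null sets of $\mathcal F_T$. $\mathcal T$ denotes the set of all stopping times $\tau\le T$ w.r.t. $(\mathcal F_t)$. $\mathcal Q$ is a nonempty set of probability measures on $\mathcal F$, each absolutely continuous w.r.t. $\mathrm P$, and $co(\mathcal Q)$ is its convex hull. $\mathcal L^1(\mathcal Q)$ is the set of random variables $X$ with $\sup_{\mathrm Q\in\mathcal Q}\mathbb E_{\mathrm Q}[|X|]<\infty$. $Y=(Y_t)_{0\le t\le T}$ is a right-continuous $(\mathcal F_t)$-adapted process with bounded paths which is quasi left-uppersemicontinuous w.r.t. $\mathrm P$, i.e. $\limsup_n Y_{\tau_n}\le Y_\tau$ $\mathrm P$-a.s. whenever $\tau_n\in\mathcal T$, $\tau_n\nearrow\tau\in\mathcal T$. $Y^*:=\sup_{t\in[0,T]}|Y_t|$. $l^\infty(\mathcal Q)$ is the space of bounded real functions on $\mathcal Q$ with the sup-norm $\|\cdot\|_\infty$, and $\mu_{\mathcal Q}:\mathcal F\to l^\infty(\mathcal Q)$ is defined by $\mu_{\mathcal Q}(A)(\mathrm Q)=\mathrm Q(A)$. *)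

(* Defs.v *)
From HB Require Import structures.
From mathcomp Require Import all_boot all_order all_algebra.
From mathcomp Require Import all_classical all_reals all_analysis measurable_realfun.
Set Implicit Arguments. Unset Strict Implicit. Unset Printing Implicit Defensive.
Import Order.TTheory GRing.Theory Num.Theory.
Import numFieldNormedType.Exports.
Local Open Scope classical_set_scope.
Local Open Scope ring_scope.

Section Defs.
Context {d : measure_display} {Omega : measurableType d} {R : realType}.

Definition filtration_usual (P : probability Omega R) (T : R)
    (F : R -> set (set Omega)) : Prop :=
  [/\ (forall t, 0 <= t <= T ->
         sigma_algebra setT (F t) /\ F t `<=` measurable),
      (forall s t, 0 <= s -> s <= t -> t <= T -> F s `<=` F t),
      (forall t, 0 <= t < T -> F t = [set A | forall s, t < s <= T -> F s A]),
      F T = measurable &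
      ((forall A, F 0 A -> (P A = 0%E \/ P A = 1%E)) /\
       (forall A, measurable A -> P A = 0%E -> F 0 A))].

Definition stopping_time (T : R) (F : R -> set (set Omega)) (tau : Omega -> R)
  : Prop :=
  (forall w, 0 <= tau w <= T) /\
  (forall t, 0 <= t <= T -> F t [set w | tau w <= t]).

Definition atomless_on (P : probability Omega R) (G : set (set Omega)) : Prop :=
  ~ (exists A, [/\ G A, (0 < P A)%E &
        forall B, G B -> B `<=` A -> P B = 0%E \/ P B = P A]).

Definition rc_adapted_bounded (T : R) (F : R -> set (set Omega))
    (Y : R -> Omega -> R) : Prop :=
  [/\ (forall w t, 0 <= t < T -> (fun s => Y s w) @ t^'+ --> Y t w),
      (forall t, 0 <= t <= T -> forall B : set R, measurable B ->
          F t (Y t @^-1` B)) &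
      (forall w, exists M : R, forall t, 0 <= t <= T -> `|Y t w| <= M)].

Definition quasi_left_usc (P : probability Omega R) (T : R)
    (F : R -> set (set Omega)) (Y : R -> Omega -> R) : Prop :=
  forall (taun : nat -> Omega -> R) (tau : Omega -> R),
    (forall n, stopping_time T F (taun n)) -> stopping_time T F tau ->
    (forall n w, taun n w <= taun n.+1 w) ->
    (forall w, (fun n => taun n w) @ \oo --> tau w) ->
    {ae P, forall w, (limn_esup (fun n => (Y (taun n w) w)%:E)
                        <= (Y (tau w) w)%:E)%E}.

Definition Ystar (T : R) (Y : R -> Omega -> R) (w : Omega) : \bar R :=
  ereal_sup [set (`|Y t w|)%:E | t in [set t | 0 <= t <= T]].

Definition in_L1 (Qs : set (probability Omega R)) (X : Omega -> \bar R) : Prop :=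
  measurable_fun setT X /\
  (ereal_sup [set (\int[Q]_w `|X w|)%E | Q in Qs] < +oo)%E.

Definition conv_hull (Qs : set (probability Omega R)) : set (probability Omega R) :=
  [set Q' | exists n (w : 'I_n -> R) (q : 'I_n -> probability Omega R),
     [/\ (forall i, 0 <= w i), \sum_(i < n) w i = 1, (forall i, Qs (q i)) &
         forall A, measurable A -> Q' A = (\sum_(i < n) (w i)%:E * q i A)%E]].

Definition tail_exp (Q : probability Omega R) (X : Omega -> \bar R) (a : R)
  : \bar R :=
  (\int[Q]_w (X w * (\1_[set w | (a%:E < X w)%E] w)%:E))%E.

Definition EYtau (Q : probability Omega R) (Y : R -> Omega -> R)
    (tau : Omega -> R) : \bar R :=
  (\int[Q]_w (Y (tau w) w)%:E)%E.

End Defs.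


(* index type of Q (with a classical choice structure) and the vector measure
   mu_Q : F -> l^oo(Q), A |-> (Q |-> Q(A)) *)
Definition Qidx {d : measure_display} {Omega : measurableType d} {R : realType}
  (Qs : set (probability Omega R)) := {Q : probability Omega R | Qs Q}.
HB.instance Definition _ d Omega R Qs := gen_eqMixin (@Qidx d Omega R Qs).
HB.instance Definition _ d Omega R Qs := gen_choiceMixin (@Qidx d Omega R Qs).

Definition muQ {d : measure_display} {Omega : measurableType d} {R : realType}
  (Qs : set (probability Omega R)) (A : set Omega)
  : {uniform Qidx Qs -> R} := fun q => fine (proj1_sig q A).
Arguments muQ {d Omega R} Qs A.

(* Main.v *)
(** The range of [mu_Q] is a totally bounded set of functions of [Q]; transposing rows
    and columns, [Qs] is totally bounded in total variation. Together with the uniform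
    tails of [Y^*] this makes [E_Q Y_tau] uniformly close, over all stopping times, to
    its values on finitely many [Q_1, ..., Q_n] in [Qs], and only a minimax statement for
    finitely many measures remains.

    The set of vectors [(E_{Q_i} Y_tau)_i] is approximately convex: replacing [tau_1] and
    [tau_2] by their maxima with a small [s > 0] costs little by right-continuity, and
    then an event [A] of the atomless sigma-algebra [F_s] can decide which of the two is
    used. An approximate form of Lyapunov's theorem provides [A]: cut [Omega] into
    small pieces and select some of them one by one, the deviation from the target growing
    at most by the squares of the small pieces. Approximate convexity implies the
    finite-dimensional minimax statement. *)
Require Import Defs.
From HB Require Import structures.
From mathcomp Require Import all_boot all_order all_algebra.
From mathcomp Require Import all_classical all_reals all_analysis measurable_realfun.
From mathcomp Require Import ring lra.
Import Order.TTheory GRing.Theory Num.Theory.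
Import numFieldNormedType.Exports.
Local Open Scope classical_set_scope.
Local Open Scope ring_scope.

(** * Approximate minimax in finite dimension *)

(** The sign of [y] is free: if [y] is negative, so is [x], and the left side vanishes. This lets an
    upper bound on a signed deficit be squared. *)
Lemma sqr_posl_le (R : realDomainType) (x y : R) :
  x <= y -> Num.max 0 x ^+ 2 <= y ^+ 2.
Proof.
move=> xy; have [x0|x0] := leP x 0.
  by rewrite expr0n/= sqr_ge0.
by rewrite ler_sqr ?nnegrE ?(ltW x0)// ltW// (lt_le_trans x0).
Qed.

(* The squared distance from the value vectors to the orthant [x >= c]
   has infimum [m] over [S]. Moving a fraction [t] towards a point that does well
   against the weights proportional to the current deficits [d] gives
   [m <= (1 - t)^2 m + O(t^2)], hence [m = 0]. *)
Lemma approx_minimax (R : realType) (n : nat) (K : Type) (S : set K)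
    (v : K -> 'I_n -> R) (M c : R) :
  S !=set0 ->
  (forall k i, S k -> `|v k i| <= M) ->
  (forall k1 k2 t e, S k1 -> S k2 -> 0 <= t <= 1 -> 0 < e ->
     exists2 k, S k & forall i, (1 - t) * v k1 i + t * v k2 i - e <= v k i) ->
  (forall l : 'I_n -> R, (forall i, 0 <= l i) -> \sum_i l i = 1 ->
     exists2 k, S k & c <= \sum_i l i * v k i) ->
  forall e, 0 < e -> exists2 k, S k & forall i, c - e <= v k i.
Proof.
move=> S0 vM mix dual e e0.
pose dd k i := Num.max 0 (c - v k i).
pose phi k := \sum_i dd k i ^+ 2.
have dd0 k i : 0 <= dd k i by rewrite /dd le_max lexx.
have phi0 k : 0 <= phi k by apply: sumr_ge0 => i _; rewrite sqr_ge0.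
have phiS : has_inf (phi @` S).
  split; first by case: S0 => k Sk; exists (phi k), k.
  by exists 0 => _ [k _ <-].
set m := inf (phi @` S).
have m0 : 0 <= m by apply: lb_le_inf; [exact: phiS.1|move=> _ [k _ <-]].
have mle k : S k -> m <= phi k.
  by move=> Sk; apply: ge_inf; [exact: phiS.2|exists k].
(* The extra [1] leaves room for the summand [t < 1] in [b] below, and makes [B <= B ^+ 2]. *)
pose B := `|c| + `|M| + 1.
have B0 : 0 < B by rewrite /B; have := normr_ge0 c; have := normr_ge0 M; lra.
have cvB k i : S k -> `|c - v k i| <= B - 1.
  move=> Sk; rewrite /B addrK (le_trans (ler_normB _ _))// lerD2l.
  by rewrite (le_trans (vM _ _ Sk))// ler_norm.
have ddB k i : S k -> dd k i <= B.
  move=> Sk; rewrite /dd ge_max (ltW B0)/=.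
  by rewrite (le_trans (ler_norm _))// (le_trans (cvB _ _ Sk))// gerBl.
pose C := n%:R * B ^+ 2.
have C0 : 0 <= C by rewrite /C mulr_ge0// sqr_ge0.
(* The near-minimizer [k] and the mixture [k3] are both taken with error [t ^+ 2], of the same order
   as the quadratic remainder. *)
have key t : 0 < t < 1 -> m <= (1 - t) ^+ 2 * (m + t ^+ 2) + 3 * t ^+ 2 * C.
  move=> /andP[t0 t1].
  have t2 : 0 < t ^+ 2 by rewrite exprn_gt0.
  have [_ [k Sk <-] km] := inf_adherent t2 phiS.
  rewrite -/m in km.
  (* If all deficits vanish, [k] already lies in the orthant and [m = 0]; otherwise the deficits can
     be normalized to weights. *)
  have [D0|D0] := eqVneq (\sum_i dd k i) 0.
    have dz i : dd k i = 0.
      by apply/eqP; move/eqP: D0; rewrite psumr_eq0// => /allP/(_ i (mem_index_enum _)).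
    have -> : m = 0.
      apply/eqP; rewrite eq_le m0 andbT (le_trans (mle _ Sk))//.
      by rewrite /phi big1// => i _; rewrite dz expr0n.
    have := sqr_ge0 (1 - t) => h1; have h2 := ltW t2; rewrite add0r.
    by apply: addr_ge0; apply: mulr_ge0 => //; apply: mulr_ge0.
  have Dp : 0 < \sum_i dd k i by rewrite lt_def D0 sumr_ge0.
  have [||k2 Sk2 ck2] := dual (fun i => dd k i / \sum_i dd k i).
  - by move=> i; rewrite divr_ge0// ltW.
  - by rewrite -mulr_suml divff.
  have [k3 Sk3 k3P] := mix k k2 t (t ^+ 2) Sk Sk2 ltac:(lra) t2.
  (* The mixing error [t ^+ 2] is written as [t * t] and absorbed here, so the deficit of [k3] is at
     most [(1 - t) * dd k i + t * b i]. *)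
  pose b i := c - v k2 i + t.
  (* The cross term: by the choice of [k2] the part without [t] is nonpositive, which removes the
     first-order term in [t]. *)
  have db : \sum_i dd k i * b i <= t * C.
    have -> : \sum_i dd k i * b i =
        (\sum_i dd k i) * (c - \sum_i dd k i / (\sum_i dd k i) * v k2 i)
        + t * \sum_i dd k i.
      rewrite mulrBr [in X in _ - X]mulr_sumr [X in X - _]mulr_suml -sumrB mulr_sumr -big_split/=.
      apply: eq_bigr => i _; rewrite /b; field; exact: D0.
    have h1 : (\sum_i dd k i) * (c - \sum_i dd k i / (\sum_i dd k i) * v k2 i) <= 0.
      by rewrite pmulr_rle0// subr_le0.
    have h2 : \sum_i dd k i <= C.
      rewrite (le_trans (ler_sum _ (fun i _ => ddB k i Sk)))//.
      rewrite sumr_const card_ord -mulr_natl /C ler_wpM2l// expr2 ler_peMl ?(ltW B0)//.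
      by rewrite /B lerDr addr_ge0.
    have : t * \sum_i dd k i <= t * C by rewrite ler_wpM2l// ltW.
    lra.
  have b2 : \sum_i b i ^+ 2 <= C.
    have h i : b i ^+ 2 <= B ^+ 2.
      rewrite -[leLHS]real_normK ?num_real// ler_sqr ?nnegrE ?(ltW B0)//.
      rewrite (le_trans (ler_normD _ _))// (gtr0_norm t0).
      have := cvB _ i Sk2; lra.
    by rewrite (le_trans (ler_sum _ (fun i _ => h i)))// sumr_const card_ord -mulr_natl.
  have phi3 : phi k3 <= (1 - t) ^+ 2 * phi k + 2 * t * (1 - t) * (\sum_i dd k i * b i)
       + t ^+ 2 * \sum_i b i ^+ 2.
    rewrite /phi !mulr_sumr -!big_split/=; apply: ler_sum => i _.
    have -> : (1 - t) ^+ 2 * dd k i ^+ 2 + 2 * t * (1 - t) * (dd k i * b i)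
       + t ^+ 2 * b i ^+ 2 = ((1 - t) * dd k i + t * b i) ^+ 2 by ring.
    apply: sqr_posl_le; have := k3P i; rewrite /b.
    have : (1 - t) * (c - v k i) <= (1 - t) * dd k i.
      by rewrite ler_wpM2l ?subr_ge0 ?(ltW t1)// /dd le_max lexx orbT.
    lra.
  apply: (le_trans (mle _ Sk3)); apply: (le_trans phi3).
  have h1 : (1 - t) ^+ 2 * phi k <= (1 - t) ^+ 2 * (m + t ^+ 2).
    by rewrite ler_wpM2l// ?sqr_ge0// ltW.
  have h2 : t ^+ 2 * \sum_i b i ^+ 2 <= t ^+ 2 * C by rewrite ler_wpM2l// ltW.
  have h3 : 2 * t * (1 - t) * (\sum_i dd k i * b i) <= 2 * t * (1 - t) * (t * C).
    by rewrite ler_wpM2l// !mulr_ge0// ?(ltW t0)//; lra.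
  have h4 : 2 * t * (1 - t) * (t * C) <= 2 * t ^+ 2 * C.
    have -> : 2 * t * (1 - t) * (t * C) = (1 - t) * (2 * t ^+ 2 * C) by ring.
    by rewrite ler_piMl// ?mulr_ge0 ?sqr_ge0//; lra.
  lra.
have mz : m <= 0.
  rewrite leNgt; apply/negP => mpos.
  (* [key] yields [2 * m <= t * A]. With [t = m / (A + m)] one has [t * A = m - t * m < 2 * m], a
     contradiction. *)
  pose A := m + 1 + 3 * C.
  have A0 : 0 < A by rewrite /A; lra.
  pose t := m / (A + m).
  have Am : 0 < A + m by lra.
  have t01 : 0 < t < 1.
    by rewrite /t divr_gt0//= ltr_pdivrMr// mul1r ltrDr.
  have tm : t * (A + m) = m by rewrite /t divfK// gt_eqF.
  have := key t t01; move/andP: t01 => [t0 t1].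
  have h1 : (1 - t) ^+ 2 * t ^+ 2 <= t ^+ 2.
    by rewrite ler_piMl ?sqr_ge0// expr_le1//; lra.
  have -> : (1 - t) ^+ 2 * (m + t ^+ 2) + 3 * t ^+ 2 * C =
     m - 2 * t * m + t ^+ 2 * m + 3 * t ^+ 2 * C + (1 - t) ^+ 2 * t ^+ 2 by ring.
  move=> h2.
  have h3 : t * (2 * m) <= t * (t * A).
    have -> : t * (t * A) = t ^+ 2 * m + t ^+ 2 + 3 * t ^+ 2 * C by rewrite /A; ring.
    lra.
  rewrite ler_pM2l// in h3.
  have : 0 < t * m by rewrite mulr_gt0.
  lra.
have e2 : 0 < e ^+ 2 by rewrite exprn_gt0.
have [_ [k Sk <-] km] := inf_adherent e2 phiS.
exists k => // i.
have : dd k i ^+ 2 <= e ^+ 2.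
  apply: le_trans (_ : phi k <= _).
    by rewrite /phi (bigD1 i)//= lerDl sumr_ge0// => j _; rewrite sqr_ge0.
  move: km; rewrite -/m; lra.
rewrite ler_sqr ?nnegrE ?(ltW e0)// => h.
have : c - v k i <= dd k i by rewrite /dd le_max lexx orbT.
lra.
Qed.

(** * Partitions into small sets *)

Section small_partition.
Context {d : measure_display} {Omega : measurableType d} {R : realType}.
Variables (P : probability Omega R) (G : set (set Omega)).
Hypothesis sG : sigma_algebra setT G.
Hypothesis Gm : G `<=` measurable.
Hypothesis atomless : atomless_on P G.

Lemma subalg0 : G set0.
Proof. by case: sG. Qed.

Lemma subalgC A : G A -> G (~` A).
Proof. by rewrite -setTD; case: sG => _ + _; exact. Qed.

Lemma subalg_bigcup (A : nat -> set Omega) : (forall k, G (A k)) -> G (\bigcup_k A k).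
Proof. by case: sG => _ _; exact. Qed.

Lemma subalgU A B : G A -> G B -> G (A `|` B).
Proof.
move=> GA GB; rewrite -bigcup2E; apply: subalg_bigcup => -[|[|k]] //=.
exact: subalg0.
Qed.

Lemma subalgI A B : G A -> G B -> G (A `&` B).
Proof.
by move=> GA GB; rewrite -(setCK (A `&` B)) setCI; apply: subalgC; apply: subalgU; exact: subalgC.
Qed.

Lemma subalgD A B : G A -> G B -> G (A `\` B).
Proof. by move=> GA GB; rewrite setDE; apply: subalgI => //; exact: subalgC. Qed.

(** Since [A] is not an atom, it splits into two parts of positive measure; the part of smaller
    measure is taken. *)
Lemma atomless_half A : G A -> (0 < P A)%E ->
  exists B, [/\ G B, B `<=` A, (0 < P B)%E & fine (P B) <= fine (P A) / 2].
Proof.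
move=> GA PA0; apply: contrapT => nB; apply: atomless; exists A; split => // B GB BA.
have mA := Gm _ GA; have mB := Gm _ GB; have GAB := subalgD _ _ GA GB.
have PAE : P A = (P B + P (A `\` B))%E.
  by rewrite -{1}(setDUK BA) measureU ?setDIK//; exact: Gm.
have [->|PBn0] := eqVneq (P B) 0%E; first by left.
have [PD0|PDn0] := eqVneq (P (A `\` B)) 0%E; first by right; rewrite PAE PD0 adde0.
exfalso; apply: nB.
have PB0 : (0 < P B)%E by rewrite lt_def PBn0 measure_ge0.
have PD0 : (0 < P (A `\` B))%E by rewrite lt_def PDn0 measure_ge0.
have fE : fine (P A) = fine (P B) + fine (P (A `\` B)).
  by rewrite PAE fineD// fin_num_measure//; exact: Gm.
have [le|lt] := leP (fine (P B)) (fine (P (A `\` B))).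
  by exists B; split => //; rewrite fE; lra.
by exists (A `\` B); split => //; rewrite fE; lra.
Qed.

Variables (n : nat) (Q : 'I_n -> probability Omega R).
Hypothesis QP : forall i, Q i `<< P.
Variable delta : R.
Hypothesis delta0 : 0 < delta.

Let small B := forall i, fine (Q i B) <= delta.

Lemma null_abs_cont i A : measurable A -> P A = 0%E -> Q i A = 0%E.
Proof. by move=> mA; have /null_content_dominatesP := QP i; apply. Qed.

(** Absolute continuity makes the intersection null for each [Q i]; continuity from above then
    applies, and finitely many [i] share an index [k]. *)
Lemma eventually_small (B : nat -> set Omega) : (forall k, G (B k)) ->
  {homo B : m n / (m <= n)%N >-> (n <= m)%O} -> P (\bigcap_k B k) = 0%E ->
  exists k, small (B k).
Proof.
move=> GB ndB PB.
have mB k : measurable (B k) by exact: Gm.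
have mcap : measurable (\bigcap_k B k) by exact: bigcapT_measurable.
have ev i : \forall k \near \oo, fine (Q i (B k)) <= delta.
  have : (Q i \o B) x @[x --> \oo] --> Q i (\bigcap_k B k).
    apply: nonincreasing_cvg_mu => //.
    by rewrite (le_lt_trans (probability_le1 _ _)) ?ltry.
  rewrite null_abs_cont// => /fine_cvgP[_] /cvgr_le; apply.
  exact: delta0.
have [K _ hK] : \forall k \near \oo, forall i, fine (Q i (B k)) <= delta.
  exact: filter_forall.
by exists K => i; apply: hK => /=.
Qed.

(** Repeated halving gives decreasing sets of positive measure at most [2^-k], whose intersection is
    null, so that [eventually_small] applies. *)
Lemma small_subset A : G A -> (0 < P A)%E ->
  exists B, [/\ G B, B `<=` A, (0 < P B)%E & small B].
Proof.
move=> GA PA.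
have [h hP] : {h : set Omega -> set Omega & forall B, G B /\ (0 < P B)%E ->
    [/\ G (h B), h B `<=` B, (0 < P (h B))%E & fine (P (h B)) <= fine (P B) / 2]}.
  apply: (@choice _ _ (fun B C => G B /\ (0 < P B)%E ->
    [/\ G C, C `<=` B, (0 < P C)%E & fine (P C) <= fine (P B) / 2])) => B.
  have [[GB PB]|nB] := pselect (G B /\ (0 < P B)%E); last by exists set0.
  by have [C CP] := atomless_half _ GB PB; exists C.
pose B k := iter k h A.
have BP k : G (B k) /\ (0 < P (B k))%E.
  by elim: k => // k /hP[? _ ?].
have BA k : B k `<=` A.
  by elim: k => // k ih; apply: subset_trans ih; case: (hP _ (BP k)).
have ndB : {homo B : m n / (m <= n)%N >-> (n <= m)%O}.
  apply/nonincreasing_seqP => k; rewrite subsetEset.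
  by case: (hP _ (BP k)).
have mB k : measurable (B k) by apply: Gm; case: (BP k).
have mcap : measurable (\bigcap_k B k) by exact: bigcapT_measurable.
have Phalf k : fine (P (B k)) <= (2^-1) ^+ k.
  elim: k => [|k ih].
    by rewrite expr0 -lee_fin fineK ?fin_num_measure// probability_le1.
  case: (hP _ (BP k)) => _ _ _ hk; rewrite exprSr (le_trans hk)//.
  by rewrite ler_wpM2r// invr_ge0.
have [|k smk] := eventually_small B (fun k => (BP k).1) ndB.
  have fz : fine (P (\bigcap_k B k)) <= 0.
    have hc : (2^-1 : R) ^+ k @[k --> \oo] --> (0 : R).
      by apply: cvg_expr; rewrite ger0_norm ?invr_ge0// invf_lt1// ltr1n.
    apply: (ler_cvg_to (cvg_cst _) hc); apply: nearW => k /=.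
    rewrite (le_trans _ (Phalf k))// fine_le ?fin_num_measure//.
    by apply: le_measure; rewrite ?inE//; apply: bigcap_inf.
  apply/eqP; rewrite eq_le measure_ge0 andbT.
  by rewrite -(fineK (fin_num_measure P _ mcap)) lee_fin.
by exists (B k); have [? ?] := BP k; split.
Qed.

(** Generated by adding one disjoint small piece at a time, so that induction on a derivation is the
    successive selection of pieces in [approx_lyapunov]. *)
Inductive small_union : set Omega -> Prop :=
| small_union0 : small_union set0
| small_unionU A B : small_union A -> G B -> small B -> A `&` B = set0 ->
    small_union (A `|` B).

Lemma small_union_subalg A : small_union A -> G A.
Proof. by elim=> [|? ? ? ? ? ? ?]; [exact: subalg0|exact: subalgU]. Qed.

Lemma small_subset_le A B : G A -> G B -> A `<=` B -> small B -> small A.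
Proof.
move=> GA GB AB sB i; apply: le_trans (sB i).
by rewrite fine_le ?fin_num_measure//; [exact: Gm|exact: Gm|
  apply: le_measure; rewrite ?inE//; exact: Gm].
Qed.

Lemma small_unionU1 A B : small_union A -> G B -> small B -> small_union (A `|` B).
Proof.
move=> sA GB sB; have GA := small_union_subalg _ sA.
have -> : A `|` B = A `|` (B `\` A) by rewrite setDE setUIr setUCr setIT.
apply: small_unionU => //; first exact: subalgD.
- by apply: small_subset_le sB; [exact: subalgD|by []|exact: subDsetl].
- by rewrite setDE setICA setICr setI0.
Qed.

Lemma small_union2 A B : small_union A -> small_union B -> small_union (A `|` B).
Proof.
move=> sA; elim=> [|C D sC ih GD sD _]; first by rewrite setU0.
by rewrite setUA; exact: small_unionU1.
Qed.

(* A finite union of small sets of maximal [P]-measure has a null complement,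
   since otherwise [small_subset] would enlarge it. *)
Lemma small_unionT : small_union setT.
Proof.
pose E := [set fine (P A) | A in small_union].
have hE : has_sup E.
  split; first by exists (fine (P set0)), set0 => //; exact: small_union0.
  exists 1 => _ [A sA <-].
  have mA := Gm _ (small_union_subalg _ sA).
  by rewrite -lee_fin fineK ?fin_num_measure// probability_le1.
have [A AP] : {A : nat -> set Omega &
    forall k, small_union (A k) /\ sup E - k.+1%:R^-1 < fine (P (A k))}.
  apply: (@choice _ _ (fun k A => small_union A /\ sup E - k.+1%:R^-1 < fine (P A))) => k.
  have k0 : 0 < (k.+1%:R^-1 : R) by rewrite invr_gt0.
  by have [_ [B sB <-] hB] := sup_adherent k0 hE; exists B.
pose C k := \big[setU/set0]_(j < k.+1) A j.
have sC k : small_union (C k).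
  rewrite /C; elim: k => [|k ih].
    by rewrite big_ord_recr/= big_ord0 set0U; case: (AP 0%N).
  by rewrite big_ord_recr/=; apply: small_union2 => //; case: (AP k.+1).
have GC k : G (C k) := small_union_subalg _ (sC k).
pose U := \bigcup_k C k.
have GU : G U by exact: subalg_bigcup.
have mU : measurable U := Gm _ GU.
have ndC m k : (m <= k)%N -> C m `<=` C k.
  by move=> mk; exact: subset_bigsetU.
(* The remainders decrease to the empty set, so one of them is small; hence the countable union [U]
   is itself a finite union of small pieces and attains the supremum. *)
have [k0 smk0] : exists k, small (U `\` C k).
  apply: eventually_small => [k||]; first exact: subalgD.
    by move=> m k mk; rewrite subsetEset; apply: setDS; exact: ndC.
  rewrite (_ : \bigcap_k _ = set0) ?measure0// -subset0 => w h.
  have [[k _ Ckw] _] := h 0%N Logic.I.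
  by have [_] := h k Logic.I.
have sU : small_union U.
  have -> : U = C k0 `|` (U `\` C k0).
    by rewrite setDUK//; exact: bigcup_sup.
  by apply: small_unionU1 => //; exact: subalgD.
have PU : sup E <= fine (P U).
  have h k : sup E - k.+1%:R^-1 <= fine (P U).
    have [sAk hk] := AP k; rewrite (le_trans (ltW hk))// fine_le ?fin_num_measure//.
      exact/Gm/small_union_subalg.
    apply: le_measure; rewrite ?inE//; first exact/Gm/small_union_subalg.
    apply: (subset_trans _ (bigcup_sup (i := k) _)) => //.
    by rewrite /C big_ord_recr/=; exact: subsetUr.
  rewrite leNgt; apply/negP => lt.
  have e0 : 0 < sup E - fine (P U) by rewrite subr_gt0.
  have [N _ /(_ N (leqnn N))/= hN] := near_infty_natSinv_lt (PosNum e0).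
  by move: hN; rewrite ltNge lerBlDl -lerBlDr h.
have PUC : P (~` U) = 0%E.
  apply/eqP; rewrite eq_le measure_ge0 andbT leNgt; apply/negP => PUC.
  have [B [GB BU PB sB]] := small_subset _ (subalgC _ GU) PUC.
  have sUB := small_unionU1 _ _ sU GB sB.
  have : fine (P (U `|` B)) <= sup E.
    by apply: ub_le_sup; [exact: hE.2|exists (U `|` B)].
  rewrite measureU//; [|exact: Gm|]; last first.
    by apply/disjoints_subset; rewrite -[U]setCK; exact: subsetC.
  rewrite fineD ?fin_num_measure//; last exact: Gm.
  have : 0 < fine (P B) by rewrite fine_gt0// PB -ge0_fin_numE// fin_num_measure//; exact: Gm.
  lra.
(* The null complement is null for every [Q i], hence small, and serves as the last piece. *)
rewrite -(setUv U); apply: small_unionU1 => //; first exact: subalgC.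
by move=> i; rewrite null_abs_cont ?ltW//; exact: measurableC.
Qed.

End small_partition.

(** * Approximate Lyapunov theorem *)

Section approximate_lyapunov.
Context {d : measure_display} {Omega : measurableType d} {R : realType}.
Variables (P : probability Omega R) (G : set (set Omega)).
Hypothesis sG : sigma_algebra setT G.
Hypothesis Gm : G `<=` measurable.
Hypothesis atomless : atomless_on P G.
Variables (n : nat) (Q : 'I_n -> probability Omega R).
Hypothesis QP : forall i, Q i `<< P.

(* The average of the two left-hand sides with weights [l] and [1 - l] is at most the
   right-hand side. *)
Lemma two_point_choice (m : nat) (l : R) (x v : 'I_m -> R) : 0 <= l <= 1 ->
  \sum_i (x i + (1 - l) * v i) ^+ 2 <= \sum_i x i ^+ 2 + \sum_i v i ^+ 2 \/
  \sum_i (x i - l * v i) ^+ 2 <= \sum_i x i ^+ 2 + \sum_i v i ^+ 2.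
Proof.
move=> /andP[l0 l1]; set a := \sum_i (_ + _) ^+ 2; set b := \sum_i (_ - _) ^+ 2.
have h : l * a + (1 - l) * b = \sum_i x i ^+ 2 + l * (1 - l) * \sum_i v i ^+ 2.
  rewrite !mulr_sumr -!big_split/=; apply: eq_bigr => i _; ring.
set s := \sum_i x i ^+ 2 in h *; set u := \sum_i v i ^+ 2 in h *.
have u0 : 0 <= u by apply: sumr_ge0 => i _; rewrite sqr_ge0.
have h2 : l * (1 - l) * u <= u by rewrite ler_piMl//; nra.
have [ab|/ltW ab] := leP a b; [left|right].
  have : 0 <= (1 - l) * (b - a) by apply: mulr_ge0; lra.
  lra.
have : 0 <= l * (a - b) by apply: mulr_ge0; lra.
lra.
Qed.

Variable f : Omega -> R.
Hypothesis intf : forall i, (Q i).-integrable setT (EFin \o f).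
Hypothesis abscont : forall eta, 0 < eta -> exists2 delta, 0 < delta &
  forall i B, measurable B -> fine (Q i B) <= delta ->
    \int[Q i]_(x in B) `|f x| <= eta.

Lemma approx_lyapunov (l e : R) : 0 <= l <= 1 -> 0 < e ->
  exists2 A, G A &
    forall i, `|\int[Q i]_(x in A) f x - l * \int[Q i]_x f x| <= e.
Proof.
move=> l01 e0.
have intfn i : (Q i).-integrable setT (EFin \o (fun x => `|f x|)).
  exact: (integrable_norm (intf i)).
have sub g i B : (Q i).-integrable setT (EFin \o g) -> measurable B ->
    (Q i).-integrable B (EFin \o g).
  by move=> ig mB; apply: integrableS ig.
pose M := \sum_i \int[Q i]_x `|f x|.
have M0 : 0 <= M by apply: sumr_ge0 => i _; exact: Rintegral_ge0.
(* Chosen so that the accumulated squared error [eta * M] is at most [e ^+ 2]; the [1] avoids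
   division by zero. *)
pose eta := e ^+ 2 / (M + 1).
have M1 : 0 < M + 1 by lra.
have eta0 : 0 < eta by rewrite divr_gt0// exprn_gt0.
have [delta delta0 deltaP] := abscont _ eta0.
(* The squared deviation grows on each piece [B] by at most the sum of the squared integrals of [f].
   One factor of each square is at most [eta], the other at most the integral of [|f|], which is
   additive over the pieces. *)
have step D : small_union G n Q delta D -> exists A, [/\ G A, A `<=` D &
    \sum_i (\int[Q i]_(x in A) f x - l * \int[Q i]_(x in D) f x) ^+ 2
    <= eta * \sum_i \int[Q i]_(x in D) `|f x|].
  elim=> [|{}D B sD [A [GA AD ih]] GB sB DB].
    exists set0; split; [exact: (subalg0 _ sG)|by []|].
    rewrite !big1 ?mulr0// => i _.
      by rewrite Rintegral_set0.
    by rewrite Rintegral_set0 mulr0 subrr expr0n.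
  have GD := small_union_subalg _ sG _ _ _ _ sD.
  have mA := Gm _ GA; have mB := Gm _ GB; have mD := Gm _ GD.
  have AB : [disjoint A & B].
    by apply/disj_set2P; rewrite -subset0 -DB; exact: setSI.
  have DB' : [disjoint D & B] by apply/disj_set2P.
  have DU g i : (Q i).-integrable setT (EFin \o g) ->
      \int[Q i]_(x in D `|` B) g x = \int[Q i]_(x in D) g x + \int[Q i]_(x in B) g x.
    by move=> ig; rewrite Rintegral_setU//; apply: sub => //; exact: measurableU.
  have AU i :
      \int[Q i]_(x in A `|` B) f x = \int[Q i]_(x in A) f x + \int[Q i]_(x in B) f x.
    by rewrite Rintegral_setU//; apply: sub => //; exact: measurableU.
  have v2 : \sum_i (\int[Q i]_(x in B) f x) ^+ 2 <=
      eta * \sum_i \int[Q i]_(x in B) `|f x|.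
    rewrite mulr_sumr; apply: ler_sum => i _.
    rewrite -[leLHS]real_normK ?num_real// expr2.
    have h := le_normr_Rintegral mB (sub _ _ _ (intf i) mB).
    by apply: ler_pM => //; rewrite (le_trans h)// deltaP.
  (* Selecting [B] shifts the deviation by [(1 - l)] times its integral vector, leaving it out by
     [- l] times that vector. *)
  have [h|h] := two_point_choice _ l
    (fun i => \int[Q i]_(x in A) f x - l * \int[Q i]_(x in D) f x)
    (fun i => \int[Q i]_(x in B) f x) l01.
  - exists (A `|` B); split; [exact: (subalgU _ sG)|exact: setSU|].
    under [X in _ * X]eq_bigr do rewrite DU//.
    rewrite big_split/= mulrDr (le_trans _ (lerD ih v2))// (le_trans _ h)//.
    by apply: ler_sum => i _; rewrite AU DU// le_eqVlt; apply/orP; left; apply/eqP; ring.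
  - exists A; split => //; first by move=> x /AD; left.
    under [X in _ * X]eq_bigr do rewrite DU//.
    rewrite big_split/= mulrDr (le_trans _ (lerD ih v2))// (le_trans _ h)//.
    by apply: ler_sum => i _; rewrite DU// le_eqVlt; apply/orP; left; apply/eqP; ring.
have [A [GA _ hA]] := step _ (small_unionT _ _ sG Gm atomless _ _ QP _ delta0).
exists A => // i.
have : (\int[Q i]_(x in A) f x - l * \int[Q i]_x f x) ^+ 2 <= e ^+ 2.
  apply: le_trans (_ : eta * M <= _).
    apply: le_trans hA.
    by rewrite (bigD1 i)//= lerDl sumr_ge0// => j _; rewrite sqr_ge0.
  by rewrite /eta -mulrA ler_piMr ?sqr_ge0// mulrC ler_pdivrMr//; lra.
by rewrite -[leLHS]real_normK ?num_real// ler_sqr// nnegrE ltW.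
Qed.

End approximate_lyapunov.

(** * Stopping times *)

Section stopping.
Context {d : measure_display} {Omega : measurableType d} {R : realType}.
Variables (P : probability Omega R) (T : R) (F : R -> set (set Omega)).
Variable (Y : R -> Omega -> R).
Hypothesis T0 : 0 < T.
Hypothesis FU : filtration_usual P T F.
Hypothesis Yrc : rc_adapted_bounded T F Y.

Lemma filtration_sigma t : 0 <= t <= T -> sigma_algebra setT (F t).
Proof. by case: FU => h _ _ _ _ /h[]. Qed.

Lemma filtration_measurable t : 0 <= t <= T -> F t `<=` measurable.
Proof. by case: FU => h _ _ _ _ /h[]. Qed.

Lemma filtration_mono s t : 0 <= s -> s <= t -> t <= T -> F s `<=` F t.
Proof. by case: FU => _ h _ _ _; exact: h. Qed.

Lemma measurable_stop tau : stopping_time T F tau -> measurable_fun setT tau.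
Proof.
move=> [tauT stau]; apply: (@measurability _ _ _ _ _ _ (@RGenOInfty.G R)).
  exact: RGenOInfty.measurableE.
move=> _ [_ [t ->] <-]; rewrite setTI.
have -> : tau @^-1` `]t, +oo[ = ~` [set w | tau w <= t].
  by apply/seteqP; split => w /=; rewrite in_itv/= andbT ltNge => /negP.
apply: measurableC; have [t0|t0] := ltP t 0.
  rewrite (_ : [set _ | _] = set0)// -subset0 => w /= wt.
  by have := tauT w; lra.
have [tT|tT] := leP t T.
  by apply: (filtration_measurable t); [rewrite t0|apply: stau; rewrite t0].
rewrite (_ : [set _ | _] = setT)// -subTset => w _ /=.
by have := tauT w; lra.
Qed.

Lemma measurable_process t : 0 <= t <= T -> measurable_fun setT (Y t).
Proof.
case: Yrc => _ aY _ tT _ B mB; rewrite setTI.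
exact: (filtration_measurable _ tT _ (aY _ tT _ mB)).
Qed.

Lemma cvg_inv_succ (c : R) : c * k.+1%:R^-1 @[k --> \oo] --> (0 : R).
Proof.
have h := @cvg_harmonic R; rewrite -[X in _ --> X](mulr0 c).
by apply: cvgM => //; exact: cvg_cst.
Qed.

(* [tau] is approximated from the right by times taking countably many values. *)
Lemma measurable_stopped tau : stopping_time T F tau ->
  measurable_fun setT (fun w => Y (tau w) w).
Proof.
move=> stau; have mtau := measurable_stop _ stau; case: stau => tauT _.
(* The right endpoint of the grid cell containing [tau w]: [k.+1] puts it strictly to the right of
   [tau w], as right limits require, unless the cap [T] is reached. *)
pose r n k : R := Num.min T (T * k.+1%:R / n.+1%:R).
pose g n w : R := tau w * (n.+1%:R / T).
pose K n w := Num.truncn (g n w).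
have g0 n w : 0 <= g n w.
  by rewrite /g mulr_ge0 ?divr_ge0// ?(ltW T0)//; case/andP: (tauT w).
have r0T n k : 0 <= r n k <= T.
  by rewrite /r ge_min lexx le_min (ltW T0)/= divr_ge0// mulr_ge0// ltW.
apply: (@measurable_fun_cvg _ _ _ _ (fun n w => Y (r n (K n w)) w)) => [n|w _].
  move=> _ B mB; rewrite setTI.
  have -> : (fun w => Y (r n (K n w)) w) @^-1` B =
      \bigcup_k ((g n @^-1` `[k%:R, k.+1%:R[) `&` (Y (r n k) @^-1` B)).
    apply/seteqP; split => w /=.
      by move=> Bw; exists (K n w) => //; split => //=; rewrite in_itv/= truncn_itv.
    move=> [k _ [/=]]; rewrite in_itv/= -truncn_eq// => /eqP Kk.
    by rewrite /K Kk.
  apply: bigcup_measurable => k _; apply: measurableI.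
    rewrite -[X in measurable X]setTI.
    have mg : measurable_fun setT (g n) by exact: measurable_funM.
    by apply: mg => //.
  by rewrite -[X in measurable X]setTI; exact: measurable_process.
have rge n : tau w <= r n (K n w).
  rewrite /r le_min; have /andP[_ ->] := tauT w; rewrite /=.
  have /andP[_ /ltW h] := truncn_itv (g0 n w).
  rewrite -/(K n w) /g in h.
  rewrite mulrA ler_pdivrMr// in h.
  by rewrite ler_pdivlMr// [leRHS]mulrC.
have rgt n : tau w < T -> tau w < r n (K n w).
  move=> h0; rewrite /r lt_min h0/=.
  have /andP[_ h] := truncn_itv (g0 n w).
  rewrite -/(K n w) /g mulrA ltr_pdivrMr// in h.
  by rewrite ltr_pdivlMr// [ltRHS]mulrC.
have rle n : r n (K n w) <= tau w + T * n.+1%:R^-1.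
  rewrite /r ge_min; apply/orP; right.
  have /andP[h _] := truncn_itv (g0 n w).
  rewrite -/(K n w) /g mulrA ler_pdivlMr// in h.
  by rewrite ler_pdivrMr// mulrDl divfK ?pnatr_eq0// -natr1 mulrDr mulr1 lerD2r mulrC.
have rcvg : r n (K n w) @[n --> \oo] --> tau w.
  apply: (@squeeze_cvgr _ _ _ _ (fun=> tau w) (fun n => tau w + T * n.+1%:R^-1)).
  - by apply: nearW => n; rewrite rge rle.
  - exact: cvg_cst.
  - rewrite -[X in _ --> X]addr0; apply: cvgD; [exact: cvg_cst|exact: cvg_inv_succ].
have [tT|tT] := ltP (tau w) T.
  case: Yrc => /(_ w (tau w)) + _ _.
  rewrite tT; case/andP: (tauT w) => -> _ /(_ isT) /cvg_at_rightP; apply.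
  by split => // n; exact: rgt.
have tE : tau w = T by apply/eqP; rewrite eq_le tT andbT; case/andP: (tauT w).
rewrite (_ : (fun n => _) = fun=> Y (tau w) w); first exact: cvg_cst.
apply/funext => n; congr (Y _ w); apply/eqP; rewrite eq_le rge andbT tE.
by case/andP: (r0T n (K n w)).
Qed.

Lemma stop_max tau s : 0 <= s <= T -> stopping_time T F tau ->
  stopping_time T F (fun w => Num.max (tau w) s).
Proof.
move=> /andP[s0 sT] [tauT stau]; split.
  by move=> w; rewrite le_max s0 orbT ge_max sT andbT; case/andP: (tauT w).
move=> t /andP[t0 tT]; have [st|ts] := leP s t.
  rewrite (_ : [set _ | _] = [set w | tau w <= t]); first by apply: stau; rewrite t0.
  by apply/seteqP; split => w /=; rewrite ge_max st andbT.
rewrite (_ : [set _ | _] = set0).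
  by apply: subalg0; apply: filtration_sigma; rewrite t0.
by rewrite -subset0 => w /=; rewrite ge_max => /andP[_]; rewrite leNgt ts.
Qed.

(** Both times wait until [s], when the occurrence of [A] is known. Before [s] nothing has stopped;
    from [s] on [A] belongs to [F t]. *)
Lemma stop_mix A s tau1 tau2 : 0 <= s <= T -> F s A ->
  stopping_time T F tau1 -> stopping_time T F tau2 ->
  (forall w, s <= tau1 w) -> (forall w, s <= tau2 w) ->
  stopping_time T F (fun w => if w \in A then tau2 w else tau1 w).
Proof.
move=> /andP[s0 sT] FA [tau1T st1] [tau2T st2] s1 s2; split.
  by move=> w; case: ifP.
move=> t /andP[t0 tT]; have t0T : 0 <= t <= T by rewrite t0.
have sF := filtration_sigma _ t0T.
have [st|ts] := leP s t.
  have FtA := filtration_mono _ _ s0 st tT _ FA.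
  rewrite (_ : [set _ | _] =
     (A `&` [set w | tau2 w <= t]) `|` (~` A `&` [set w | tau1 w <= t])).
    apply: (subalgU _ sF); apply: (subalgI _ sF) => //.
    - exact: st2.
    - exact: (subalgC _ sF).
    - exact: st1.
  apply/seteqP; split => w /=.
    case: ifPn => [/set_mem|/negP] h h2; [by left|right; split => //].
    by move=> /mem_set.
  move=> [[/mem_set -> //]|[nA]]; case: ifPn => // /set_mem //.
rewrite (_ : [set _ | _] = set0); first exact: (subalg0 _ sF).
rewrite -subset0 => w /=; case: ifP => _ h.
  by have := le_lt_trans (le_trans (s2 w) h) ts; rewrite ltxx.
by have := le_lt_trans (le_trans (s1 w) h) ts; rewrite ltxx.
Qed.

Let S w := fine (Ystar T Y w).

Lemma Ystar_fin w : Ystar T Y w \is a fin_num.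
Proof.
case: Yrc => _ _ /(_ w)[M hM]; rewrite ge0_fin_numE.
  apply: (@le_lt_trans _ _ M%:E); last exact: ltry.
  by apply: ge_ereal_sup => _ [t ht <-]; rewrite lee_fin; exact: hM.
apply: (@le_trans _ _ (`|Y 0 w|)%:E); first by rewrite lee_fin.
by apply: ereal_sup_ubound; exists 0 => //=; rewrite lexx ltW.
Qed.

Lemma process_le w t : 0 <= t <= T -> `|Y t w| <= S w.
Proof.
move=> tT; rewrite -lee_fin /S fineK ?Ystar_fin//.
by apply: ereal_sup_ubound; exists t.
Qed.

Lemma integrable_stopped (Q : probability Omega R) tau : stopping_time T F tau ->
  Q.-integrable setT (EFin \o S) ->
  Q.-integrable setT (EFin \o (fun w => Y (tau w) w)).
Proof.
move=> stau; apply: le_integrable => //.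
  by apply/measurable_EFinP; exact: measurable_stopped.
move=> w _ /=; rewrite lee_fin (le_trans (process_le _ _ _)) ?ler_norm//.
by case: stau.
Qed.

(** Dominated convergence with majorant [S]. Pointwise the sequence is eventually constant where
    [tau] is positive, and converges by right-continuity at [0] where [tau] vanishes. *)
Lemma cvg_stop_max (Q : probability Omega R) tau : stopping_time T F tau ->
  Q.-integrable setT (EFin \o S) ->
  \int[Q]_w Y (Num.max (tau w) (T * k.+1%:R^-1)) w @[k --> \oo]
    --> \int[Q]_w Y (tau w) w.
Proof.
move=> stau iS.
have tk k : 0 <= T * k.+1%:R^-1 <= T.
  rewrite mulr_ge0 ?(ltW T0)//= ler_piMr ?(ltW T0)// invf_le1// ler1n//.
have sk k := stop_max _ _ (tk k) stau.
have cw w : Y (Num.max (tau w) (T * k.+1%:R^-1)) w @[k --> \oo] --> Y (tau w) w.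
  have [tau0|tau0] := ltP 0 (tau w).
    apply: cvg_near_cst.
    have := cvg_inv_succ T => /cvgr_lt /(_ _ tau0); apply: filterS => k hk.
    by rewrite max_l// ltW.
  have tE : tau w = 0 by apply/eqP; rewrite eq_le tau0; case: stau => /(_ w)/andP[->].
  rewrite tE; case: Yrc => /(_ w 0) + _ _.
  rewrite lexx T0 => /(_ isT) /cvg_at_rightP; apply.
  split => [k|].
    by rewrite lt_max (_ : 0 < T * _) ?orbT// mulr_gt0// invr_gt0.
  rewrite (_ : (fun k => _) = (fun k => T * k.+1%:R^-1)); first exact: cvg_inv_succ.
  by apply/funext => k; rewrite max_r//; case/andP: (tk k).
have [_ _] := @dominated_convergence _ _ _ Q setT measurableT
  (fun k w => (Y (Num.max (tau w) (T * k.+1%:R^-1)) w)%:E)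
  (fun w => (Y (tau w) w)%:E) (EFin \o S)
  ltac:(move=> k; apply/measurable_EFinP; exact: measurable_stopped (sk k))
  ltac:(apply/measurable_EFinP; exact: measurable_stopped stau)
  ltac:(apply: aeW => w _; apply: cvg_EFin; [exact: nearW|exact: cw])
  iS
  ltac:(apply: aeW => w k _; rewrite lee_fin; apply: process_le; by case: (sk k)).
rewrite -(fineK (integrable_fin_num measurableT (integrable_stopped _ _ stau iS))).
exact: fine_cvg.
Qed.

Variables (n : nat) (Q : 'I_n -> probability Omega R).
Hypothesis QP : forall i, Q i `<< P.
Hypothesis atomless : forall t, 0 < t <= T -> atomless_on P (F t).
Hypothesis intS : forall i, (Q i).-integrable setT (EFin \o S).
Hypothesis abscont : forall eta, 0 < eta -> exists2 delta, 0 < delta &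
  forall i B, measurable B -> fine (Q i B) <= delta ->
    \int[Q i]_(x in B) S x <= eta.

(** Approximate convexity of the value vectors. One [e / 3] is reserved for delaying each of the two
    times to [s], and one for the approximate Lyapunov theorem in [F s]. *)
Lemma stopping_mixture tau1 tau2 l e : stopping_time T F tau1 ->
  stopping_time T F tau2 -> 0 <= l <= 1 -> 0 < e ->
  exists2 tau, stopping_time T F tau & forall i,
    (1 - l) * \int[Q i]_w Y (tau1 w) w + l * \int[Q i]_w Y (tau2 w) w - e
    <= \int[Q i]_w Y (tau w) w.
Proof.
move=> st1 st2 l01 e0.
have e3 : 0 < e / 3 by rewrite divr_gt0.
have ev tau : stopping_time T F tau -> \forall k \near \oo, forall i,
    \int[Q i]_w Y (tau w) w - e / 3 <=
    \int[Q i]_w Y (Num.max (tau w) (T * k.+1%:R^-1)) w.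
  move=> stau; apply: filter_forall => i.
  have /cvgr_ge := cvg_stop_max (Q i) _ stau (intS i).
  by apply; rewrite ltrBlDr ltrDl.
have [k [h1 h2]] : exists k, (forall i, \int[Q i]_w Y (tau1 w) w - e / 3 <=
    \int[Q i]_w Y (Num.max (tau1 w) (T * k.+1%:R^-1)) w) /\
   (forall i, \int[Q i]_w Y (tau2 w) w - e / 3 <=
    \int[Q i]_w Y (Num.max (tau2 w) (T * k.+1%:R^-1)) w).
  have [N _ hN] := filterI (ev _ st1) (ev _ st2).
  by exists N; apply: hN => /=.
set s := T * k.+1%:R^-1 in h1 h2.
have s0 : 0 < s by rewrite mulr_gt0// invr_gt0.
have sT : s <= T by rewrite ler_piMr ?(ltW T0)// invf_le1// ler1n.
have s0T : 0 <= s <= T by rewrite (ltW s0).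
have sT' : 0 < s <= T by rewrite s0.
have sm1 := stop_max _ _ s0T st1; have sm2 := stop_max _ _ s0T st2.
pose Y1 w := Y (Num.max (tau1 w) s) w; pose Y2 w := Y (Num.max (tau2 w) s) w.
have i1 i : (Q i).-integrable setT (EFin \o Y1) := integrable_stopped _ _ sm1 (intS i).
have i2 i : (Q i).-integrable setT (EFin \o Y2) := integrable_stopped _ _ sm2 (intS i).
(* The gain from switching to the second time: switching on [A] adds the integral of [f] over [A],
   which should be close to [l] times the full integral. *)
pose f w := Y2 w - Y1 w.
have intf i : (Q i).-integrable setT (EFin \o f).
  rewrite (_ : EFin \o f = (EFin \o Y2) \- (EFin \o Y1))%E; last first.
    by apply/funext => w; rewrite /f/= EFinB.
  by apply: integrableB; [exact: measurableT|exact: i2|exact: i1].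
have acf eta : 0 < eta -> exists2 delta, 0 < delta &
    forall i B, measurable B -> fine (Q i B) <= delta ->
    \int[Q i]_(x in B) `|f x| <= eta.
  move=> eta0; have eta2 : 0 < eta / 2 by rewrite divr_gt0.
  have [delta d0 hd] := abscont _ eta2; exists delta => // i B mB QB.
  have iSB : (Q i).-integrable B (EFin \o S) by apply: integrableS (intS i).
  apply: (@le_trans _ _ (\int[Q i]_(x in B) (2 * S x))).
    apply: le_Rintegral => //.
    - apply: (@integrable_norm _ _ _ _ B f); exact: integrableS (intf i).
    - rewrite (_ : EFin \o _ = (fun x => 2%:E * (EFin \o S) x)%E).
        exact: integrableZl.
      by apply/funext => x /=; rewrite EFinM.
    move=> w _; rewrite /f (le_trans (ler_normB _ _))// mulr_natl mulr2n.
    by apply: lerD; apply: process_le; [case: sm2|case: sm1].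
  rewrite RintegralZl//; have := hd i B mB QB; lra.
have [A FA hA] := approx_lyapunov P (F s) (filtration_sigma _ s0T)
  (filtration_measurable _ s0T) (atomless s sT') n Q QP f intf acf
  _ _ l01 e3.
have mA := filtration_measurable _ s0T _ FA.
exists (fun w => if w \in A then Num.max (tau2 w) s else Num.max (tau1 w) s).
  by apply: (stop_mix _ s) => // w; rewrite le_max lexx orbT.
move=> i.
have -> : \int[Q i]_w Y (if w \in A then Num.max (tau2 w) s else Num.max (tau1 w) s) w
   = \int[Q i]_w Y1 w + \int[Q i]_(w in A) f w.
  rewrite [X in _ + X]Rintegral_mkcond -RintegralD//.
    apply: eq_Rintegral => w _; rewrite patchE /f /Y1 /Y2.
    by case: ifP => _; rewrite ?addr0// addrC subrK.
  - exact: i1.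
  rewrite (_ : EFin \o _ = ((EFin \o f) \_ A)); last by rewrite restrict_EFin.
  by rewrite -integrable_mkcond//; exact: integrableS (intf i).
have fB : \int[Q i]_w f w = \int[Q i]_w Y2 w - \int[Q i]_w Y1 w.
  exact: (RintegralB measurableT (i2 i) (i1 i)).
have := hA i; rewrite ler_norml fB => /andP[hAi _].
have g1 := h1 i; have g2 := h2 i; case/andP: l01 => l0 l1.
rewrite -/(Y1 _) in g1; rewrite -/(Y2 _) in g2.
set a1 := \int[Q i]_w Y1 w in hAi g1 *; set a2 := \int[Q i]_w Y2 w in hAi g2 *.
set b1 := \int[Q i]_w Y (tau1 w) w in g1 *; set b2 := \int[Q i]_w Y (tau2 w) w in g2 *.
have q1 : (1 - l) * (b1 - e / 3) <= (1 - l) * a1 by rewrite ler_wpM2l//; lra.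
have q2 : l * (b2 - e / 3) <= l * a2 by rewrite ler_wpM2l.
lra.
Qed.

End stopping.

(** * Total variation *)

Section total_variation.
Context {d : measure_display} {Omega : measurableType d} {R : realType}.
Implicit Types Q : probability Omega R.

(** Layer-cake formula: the integrals are those of the tail probabilities over levels [r >= 0].
    These differ by at most [e] for [r <= a] and vanish beyond [a]. *)
Lemma Rintegral_tv_le Q1 Q2 (Z : Omega -> R) (a e : R) :
  measurable_fun setT Z -> (forall w, 0 <= Z w <= a) -> 0 <= a -> 0 <= e ->
  (forall A, measurable A -> fine (Q1 A) <= fine (Q2 A) + e) ->
  \int[Q1]_w Z w <= \int[Q2]_w Z w + a * e.
Proof.
move=> mZ Z0a a0 e0 Q12.
have Z0 w : 0 <= Z w by case/andP: (Z0a w).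
have iZ Q : Q.-integrable setT (EFin \o Z).
  apply: measurable_bounded_integrable => //.
    by rewrite (le_lt_trans (probability_le1 _ _)) ?ltry.
  exists a; split; first exact: num_real.
  by move=> x ax w _ /=; rewrite ger0_norm// (le_trans _ (ltW ax))//; case/andP: (Z0a w).
pose X : {mfun Omega >-> R} := mfun_Sub (mem_set mZ).
have layer Q : (\int[Q]_w (Z w)%:E = \int[lebesgue_measure]_(r in `[0%R, +oo[)
    ccdf (P := Q) X r)%E.
  by rewrite -ge0_expectation_ccdf// expectation_def.
have layerR Q : ((\int[Q]_w Z w)%:E = \int[lebesgue_measure]_(r in `[0%R, +oo[)
    ccdf (P := Q) X r)%E.
  by rewrite -layer /Rintegral (fineK (integrable_fin_num measurableT (iZ Q))).
rewrite -lee_fin EFinD !layerR.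
have mD : measurable (`[0%R, +oo[%classic : set R) by [].
have mc Q : measurable_fun (`[0%R, +oo[%classic : set R) (ccdf (P := Q) X).
  by apply: measurable_funTS; exact: ccdf_measurable.
have me : measurable_fun (`[0%R, +oo[%classic : set R)
    (fun r => (e * \1_(`[0, a]%classic) r)%:E).
  by apply/measurable_EFinP; apply: measurable_funTS; exact: measurable_funM.
have -> : (a * e)%:E = (\int[lebesgue_measure]_(r in `[0%R, +oo[)
    (e * \1_(`[0, a]%classic) r)%:E)%E.
  under eq_integral do rewrite EFinM.
  rewrite ge0_integralZl_EFin//; first last.
    by apply/measurable_EFinP; exact: measurable_funTS.
  rewrite integral_indic// setIidl; last first.
    by move=> r /=; rewrite !in_itv/= andbT => /andP[].
  have mua : lebesgue_measure (`[0%R, a]%classic : set R) = a%:E.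
    by rewrite lebesgue_measure_itv/= lte_fin; case: ltgtP a0 => // [a0 _|<- _];
      rewrite ?oppr0 ?adde0.
  by rewrite EFinM muleC; congr (_ * _)%E; rewrite -mua.
have ge0e (r : R) : (0 <= (e * \1_(`[0, a]%classic) r)%:E)%E by rewrite lee_fin mulr_ge0.
rewrite -ge0_integralD; [|exact: mD|by []|exact: mc|by []|exact: me].
apply: ge0_le_integral; [exact: mD|by []|exact: mc| |].
- by apply: emeasurable_funD; [exact: mc|exact: me].
move=> r /=; rewrite in_itv/= andbT => r0; rewrite /ccdf/= /distribution/= /pushforward.
have mr : measurable (X @^-1` `]r, +oo[).
  by rewrite -[V in measurable V]setTI; exact: (mZ measurableT).
have [ra|ar] := leP r a.
  rewrite indicE mem_set/= ?in_itv/= ?r0// mulr1.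
  rewrite -[leLHS]fineK ?fin_num_measure// -[X in (_ <= X + _)%E]fineK ?fin_num_measure//.
  by rewrite -EFinD lee_fin Q12.
rewrite (_ : X @^-1` _ = set0); first by rewrite measure0 adde_ge0// lee_fin mulr_ge0.
rewrite -subset0 => w /=; rewrite in_itv/= andbT => rZ.
have := lt_trans ar rZ; rewrite ltNge; case/andP: (Z0a w) => _.
by move=> h; rewrite h.
Qed.

Lemma integrable_tail Q (S : Omega -> R) a : measurable_fun setT S ->
  Q.-integrable setT (EFin \o S) ->
  Q.-integrable setT (EFin \o (fun w => S w * \1_[set w | a < S w] w)).
Proof.
move=> mS; apply: le_integrable => //.
  apply/measurable_EFinP; apply: measurable_funM => //; apply: measurable_indic.
  have -> : [set w | a < S w] = S @^-1` `]a, +oo[.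
    by apply/seteqP; split => w /=; rewrite in_itv/= andbT.
  by rewrite -[X in measurable X]setTI; exact: mS.
move=> w _ /=; rewrite lee_fin normrM ler_piMr// indicE.
by case: (_ \in _); rewrite ?normr1 ?normr0.
Qed.

Lemma le_tail (S : Omega -> R) a w : 0 <= a -> 0 <= S w ->
  S w <= a + S w * \1_[set w | a < S w] w.
Proof.
move=> a0 S0; rewrite indicE; have [aS|Sa] := ltP a (S w).
  by rewrite mem_set//= mulr1 lerDr.
by rewrite memNset ?mulr0 ?addr0//=; apply/negP; rewrite -leNgt.
Qed.

(** Integrates [le_tail] over [B]. With uniform tails this makes the integral of [S] small on sets
    of small measure. *)
Lemma Rintegral_le_tail Q (S : Omega -> R) a B : measurable_fun setT S ->
  (forall w, 0 <= S w) -> 0 <= a -> Q.-integrable setT (EFin \o S) -> measurable B ->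
  \int[Q]_(x in B) S x <= a * fine (Q B) + \int[Q]_w (S w * \1_[set w | a < S w] w).
Proof.
move=> mS S0 a0 iS mB.
pose t w := S w * \1_[set w | a < S w] w.
have it : Q.-integrable setT (EFin \o t) by exact: integrable_tail.
have ia : Q.-integrable B (EFin \o cst a) by exact: finite_measure_integrable_cst.
have itB : Q.-integrable B (EFin \o t) by apply: integrableS it.
apply: (@le_trans _ _ (\int[Q]_(x in B) (cst a x + t x))).
  apply: le_Rintegral => //; first exact: integrableS iS.
    rewrite (_ : EFin \o _ = (EFin \o cst a) \+ (EFin \o t))%E//.
    exact: integrableD.
  by move=> w _; exact: le_tail.
rewrite RintegralD// Rintegral_cst// lerD2l.
rewrite Rintegral_mkcond; apply: le_Rintegral => //.
  by rewrite -restrict_EFin -integrable_mkcond.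
by move=> w _; rewrite patchE; case: ifP => // _; rewrite mulr_ge0.
Qed.

(* Truncate at level [a], compare the bounded parts in total variation
   and charge the rest to the tails of [S]. *)
Lemma Rintegral_tv_tail_le Q1 Q2 (X S : Omega -> R) (a e eta : R) :
  measurable_fun setT X -> measurable_fun setT S -> (forall w, `|X w| <= S w) ->
  0 <= a -> 0 <= e ->
  Q1.-integrable setT (EFin \o S) -> Q2.-integrable setT (EFin \o S) ->
  \int[Q1]_w (S w * \1_[set w | a < S w] w) <= eta ->
  \int[Q2]_w (S w * \1_[set w | a < S w] w) <= eta ->
  (forall A, measurable A -> fine (Q1 A) <= fine (Q2 A) + e) ->
  \int[Q1]_w X w <= \int[Q2]_w X w + 2 * a * e + 2 * eta.
Proof.
move=> mX mS XS a0 e0 i1 i2 t1 t2 Q12.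
pose t w := S w * \1_[set w | a < S w] w.
(* The truncation of [X] to [[-a, a]], shifted by [a] to be nonnegative; hence the bound [2 * a]. *)
pose Z w := Num.max (- a) (Num.min a (X w)) + a.
have mZ : measurable_fun setT Z.
  apply: measurable_funD => //; apply: measurable_maxr => //.
  exact: measurable_minr.
have Z0 w : 0 <= Z w <= 2 * a.
  rewrite /Z; have [] := leP a (X w); have [] := leP (- a) _ => /=; lra.
have Za w : `|X w - (Z w - a)| <= t w.
  have h := le_tail _ _ _ a0 (le_trans (normr_ge0 _) (XS w)).
  rewrite -/(t w) in h.
  have tw : 0 <= t w by rewrite mulr_ge0// (le_trans _ (XS w)).
  have := XS w; rewrite /Z ler_norml => /andP[h1 h2].
  rewrite ler_norml; have [] := leP a (X w); have [] := leP (- a) _ => /=; lra.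
have iX Q : Q.-integrable setT (EFin \o S) -> Q.-integrable setT (EFin \o X).
  apply: le_integrable => //; first exact/measurable_EFinP.
  by move=> w _ /=; rewrite lee_fin (le_trans (XS w))// ler_norm.
have iZ Q : Q.-integrable setT (EFin \o Z).
  apply: measurable_bounded_integrable => //.
    by rewrite (le_lt_trans (probability_le1 _ _)) ?ltry.
  exists (2 * a); split; first exact: num_real.
  move=> x ax w _ /=; case/andP: (Z0 w) => z0 z1.
  by rewrite ger0_norm// (le_trans z1)// ltW.
have it Q : Q.-integrable setT (EFin \o S) -> Q.-integrable setT (EFin \o t).
  exact: integrable_tail.
have ia Q : Q.-integrable setT (EFin \o cst a) by exact: finite_measure_integrable_cst.
have Ea Q : \int[Q]_w cst a w = a 
  by transitivity (a * fine (Q setT)); [exact: Rintegral_cst|rewrite probability_setT mulr1].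
have iZa Q : Q.-integrable setT (EFin \o (fun w => Z w - cst a w)).
  rewrite (_ : EFin \o _ = (EFin \o Z) \- (EFin \o cst a))%E//.
  by apply: integrableB; [exact: measurableT|exact: iZ|exact: ia].
have EZa Q : \int[Q]_w (Z w - cst a w) = \int[Q]_w Z w - a.
  by rewrite (RintegralB measurableT (iZ Q) (ia Q)); congr (_ - _); exact: Ea.
have h1 : \int[Q1]_w X w <= \int[Q1]_w Z w - a + eta.
  rewrite (le_trans _ (lerD (lexx _) t1))// -EZa -RintegralD//; [|exact: iZa|exact: it].
  apply: le_Rintegral => //; first exact: iX.
    rewrite (_ : EFin \o _ = (EFin \o (fun w => Z w - cst a w)%R) \+ (EFin \o t))%E//.
    by apply: integrableD; [exact: measurableT|exact: iZa|exact: it].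
  by move=> w _; have := Za w; rewrite ler_norml => /andP[_]; rewrite /t/=; lra.
have h2 : \int[Q2]_w Z w - a <= \int[Q2]_w X w + eta.
  rewrite (le_trans _ (lerD (lexx _) t2))// -EZa -RintegralD//; [|exact: iX|exact: it].
  apply: le_Rintegral => //; first exact: iZa.
    rewrite (_ : EFin \o _ = (EFin \o X) \+ (EFin \o t))%E//.
    by apply: integrableD; [exact: measurableT|exact: iX|exact: it].
  by move=> w _; have := Za w; rewrite ler_norml => /andP[+ _]; rewrite /t/=; lra.
have a20 : 0 <= 2 * a by rewrite mulr_ge0.
have := Rintegral_tv_le _ _ _ _ _ mZ Z0 a20 e0 Q12; lra.
Qed.

Variable Qs : set (probability Omega R).

(** Total boundedness of the range, with centres taken in the range itself rather than in its
    closure. *)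
Lemma muQ_range_net (e : R) : 0 < e -> compact (closure [set muQ Qs A | A in measurable]) ->
  exists s : set (set Omega), [/\ finite_set s, s `<=` measurable &
    forall A, measurable A -> exists2 B, s B &
      forall Q, Qs Q -> `|fine (Q A) - fine (Q B)| <= e].
Proof.
move=> e0 /compact_near_coveringP cov.
(* Compactness is used in its near-covering form, along the finite families of measurable sets
   directed by inclusion: each point needs one set [B] nearby, and compactness makes finitely many
   suffice. *)
pose FF : set_system (set (set Omega)) := fun U => exists s0,
  [/\ finite_set s0, s0 `<=` measurable & forall s, s0 `<=` s -> U s].
have FFF : Filter FF.
  split.
  - by exists set0; split.
  - move=> U V [s [fs ms Us]] [t [ft mt Vt]]; exists (s `|` t); split.
    + by rewrite finite_setU.
    + by move=> A [/ms|/mt].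
    + by move=> r str; split; [apply: Us|apply: Vt] => A ?; apply: str; [left|right].
  - by move=> U V UV [s [fs ms Us]]; exists s; split => // t /Us /UV.
pose PP (s : set (set Omega)) (x : {uniform Qidx Qs -> R}) :=
  exists2 B, s B & forall q, `|x q - muQ Qs B q| <= e.
have [|s [fs ms sP]] := cov _ FF PP FFF.
  move=> x clx; have e2 : 0 < e / 2 by rewrite divr_gt0.
  have nbx : nbhs x [set h : {uniform Qidx Qs -> R} | forall q, `|x q - h q| < e / 2].
    apply/uniform_nbhs; exists [set uv | `|uv.1 - uv.2| < e / 2]; split.
      exact: entourage_ball (PosNum e2).
    by move=> h /= hh q; exact: hh.
  have [_ [[B mB <-] hB]] := clx _ nbx.
  exists ([set h : {uniform Qidx Qs -> R} | forall q, `|x q - h q| < e / 2],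
     [set s : set (set Omega) | s B]); first split => //=.
    exists [set B]; split => //; first by move=> _ ->.
    by move=> s; apply.
  move=> [h s] /= [hx sB]; exists B => // q.
  rewrite (_ : h q - _ = (h q - x q) + (x q - muQ Qs B q)); last by rewrite addrA subrK.
  rewrite (splitr e) (le_trans (ler_normD _ _))//.
  by apply: lerD; apply: ltW; [rewrite distrC; exact: hx|exact: hB].
exists s; split => // A mA.
have [|B sB hB] := sP s (fun _ h => h) (muQ Qs A).
  by apply: subset_closure; exists A.
by exists B => // Q QQ; exact: (hB (exist _ Q QQ)).
Qed.

(* Uniform closeness of the rows [A |-> (Q |-> Q A)] to finitely many of them makes the
   columns [Q] uniformly close to finitely many of them: it suffices to bin the values of
   [Q] on the finite net of sets. *)
Lemma finite_tv_net (e : R) : Qs !=set0 -> 0 < e ->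
  compact (closure [set muQ Qs A | A in measurable]) ->
  exists n (q : 'I_n -> probability Omega R), (forall i, Qs (q i)) /\
    forall Q, Qs Q -> exists i, forall A, measurable A ->
      `|fine (Q A) - fine (q i A)| <= e.
Proof.
move=> [Q0 QsQ0] e0 cpt.
have e3 : 0 < e / 3 by rewrite divr_gt0.
have [s [/finite_seqP[l sl] ms net]] := muQ_range_net _ e3 cpt.
have [K _ /(_ K (leqnn K))/= hK] := near_infty_natSinv_lt (PosNum e3).
pose m := size l.
pose g Q (j : 'I_m) := fine (Q (nth set0 l j)) * K.+1%:R.
(* Bins of width [1 / (K + 1)], below [e / 3]. The probability [1] falls into bin [K + 1], so
   [K + 2] bins are needed. *)
pose b Q : {ffun 'I_m -> 'I_K.+2} := [ffun j => inord (Num.truncn (g Q j))].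
have lm (j : 'I_m) : measurable (nth set0 l j).
  by apply: ms; rewrite sl /=; apply: mem_nth.
have g0 Q j : 0 <= g Q j by rewrite mulr_ge0// fine_ge0.
have gK Q j : (Num.truncn (g Q j) < K.+2)%N.
  rewrite truncn_lt_nat// (le_lt_trans (y := K.+1%:R)) ?ltr_nat//.
  rewrite /g ler_piMl// -lee_fin fineK ?fin_num_measure//.
  exact: probability_le1.
have bP Q1 Q2 : b Q1 = b Q2 -> forall j : 'I_m,
    `|fine (Q1 (nth set0 l j)) - fine (Q2 (nth set0 l j))| <= e / 3.
  move=> /ffunP b12 j; have := congr1 val (b12 j); rewrite !ffunE/= !inordK// => tE.
  have /andP[a1 a2] := truncn_itv (g0 Q1 j); have /andP[c1 c2] := truncn_itv (g0 Q2 j).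
  rewrite -tE in c1 c2; apply: le_trans (ltW hK).
  rewrite -[leLHS](@mulfK _ K.+1%:R) ?pnatr_eq0// ler_pdivrMr// mulVf ?pnatr_eq0//.
  rewrite -[X in _ * X](@ger0_norm _ K.+1%:R)// -normrM mulrBl ler_norml.
  move: a1 a2 c1 c2; rewrite /g -natr1; lra.
(* One representative in [Qs] for each bin vector; [Q0] is the default for vectors that do not
   occur. *)
have [rep repP] : {rep : {ffun 'I_m -> 'I_K.+2} -> probability Omega R & forall v,
    Qs (rep v) /\ ((exists2 Q, Qs Q & b Q = v) -> b (rep v) = v)}.
  apply: (@choice _ _ (fun v Q => Qs Q /\ ((exists2 Q, Qs Q & b Q = v) -> b Q = v))) => v.
  have [[Q QQ bQ]|nQ] := pselect (exists2 Q, Qs Q & b Q = v); first by exists Q.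
  by exists Q0; split => // /nQ.
exists #|{ffun 'I_m -> 'I_K.+2}|, (fun i => rep (enum_val i)); split.
  by move=> i; case: (repP (enum_val i)).
move=> Q QQ; exists (enum_rank (b Q)) => A mA; rewrite enum_rankK.
case: (repP (b Q)); set Q' := rep (b Q) => QQ' /(_ (ex_intro2 _ _ Q QQ erefl)) bE.
have [B] := net _ mA; rewrite sl /= => lB hB.
have jm : (index B l < m)%N by rewrite index_mem.
have := bP _ _ bE (Ordinal jm); rewrite /= nth_index// => h1.
have h2 := hB _ QQ; have h3 := hB _ QQ'.
move: h1 h2 h3; rewrite !ler_norml; lra.
Qed.

End total_variation.

(** * Convex combinations of probability measures *)

Section convex_hull.
Context {d : measure_display} {Omega : measurableType d} {R : realType}.
Variables (n : nat) (w : 'I_n -> R) (q : 'I_n -> probability Omega R).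
Hypothesis w0 : forall i, 0 <= w i.

(** [msum] takes a family indexed by [nat]; indices from [n] on receive the zero measure by
    default. *)
Let m_ (k : nat) : {measure set Omega -> \bar R} :=
  if insub k is Some i then mscale (NngNum (w0 i)) (q i) else mzero.

Let m_E (i : 'I_n) : m_ i = mscale (NngNum (w0 i)) (q i).
Proof. by rewrite /m_ valK. Qed.

Let msumE A : msum m_ n A = (\sum_(i < n) (w i)%:E * q i A)%E.
Proof. by rewrite /msum; apply: eq_bigr => i _; rewrite m_E. Qed.

Lemma conv_comb_probability : \sum_i w i = 1 -> exists Q : probability Omega R,
  forall A, Q A = (\sum_(i < n) (w i)%:E * q i A)%E.
Proof.
move=> w1.
have [i0 _] : exists i : 'I_n, true.
  have : \sum_i w i != 0 by rewrite w1 oner_neq0.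
  case: n w q => [w' q'|k _ _ _]; [by rewrite big_ord0 eqxx|by exists ord0].
pose mu : {measure set Omega -> \bar R} := msum m_ n.
have mT : mu setT = 1%E.
  rewrite [LHS]msumE (eq_bigr (fun i => (w i)%:E)); first by rewrite sumEFin w1.
  by move=> i _; rewrite probability_setT mule1.
(* The total mass is already [1]; normalizing only supplies the structure of a probability
   measure. *)
exists (mnormalize mu (q i0)) => A.
rewrite /= /mnormalize mT/= onee_eq0/= invr1 mule1; exact: msumE.
Qed.

Variable Q : probability Omega R.
Hypothesis Qwq : forall A, measurable A -> Q A = (\sum_(i < n) (w i)%:E * q i A)%E.

Lemma ge0_integral_conv_comb (f : Omega -> \bar R) : measurable_fun setT f ->
  (forall x, 0 <= f x)%E ->
  (\int[Q]_x f x = \sum_(i < n) (w i)%:E * \int[q i]_x f x)%E.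
Proof.
move=> mf f0; rewrite (eq_measure_integral (msum m_ n)); last first.
  by move=> A mA _; rewrite [RHS]msumE; exact: Qwq.
rewrite ge0_integral_measure_sum//; apply: eq_bigr => i _.
by rewrite m_E ge0_integral_mscale.
Qed.

Lemma ge0_Rintegral_conv_comb (f : Omega -> R) : (forall x, 0 <= f x) ->
  (forall i, (q i).-integrable setT (EFin \o f)) -> measurable_fun setT f ->
  (\int[Q]_x (f x)%:E = (\sum_i w i * \int[q i]_x f x)%:E)%E.
Proof.
move=> f0 qf mf; rewrite ge0_integral_conv_comb//; last exact/measurable_EFinP.
rewrite -sumEFin; apply: eq_bigr => i _.
by rewrite EFinM /Rintegral (fineK (integrable_fin_num measurableT (qf i))).
Qed.

Lemma integrable_conv_comb (f : Omega -> R) : measurable_fun setT f ->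
  (forall i, (q i).-integrable setT (EFin \o f)) ->
  Q.-integrable setT (EFin \o f).
Proof.
move=> mf qf; apply/integrableP; split; first exact/measurable_EFinP.
rewrite (eq_integral (fun x => (`|f x|)%:E))//.
rewrite ge0_Rintegral_conv_comb ?ltry//; last exact: measurableT_comp.
by move=> i; exact: (integrable_norm (qf i)).
Qed.

(* [f] is the difference of the nonnegative functions [`|f| + f] and [`|f|]. *)
Lemma Rintegral_conv_comb (f : Omega -> R) : measurable_fun setT f ->
  (forall i, (q i).-integrable setT (EFin \o f)) ->
  \int[Q]_x f x = \sum_i w i * \int[q i]_x f x.
Proof.
move=> mf qf; have iQ := integrable_conv_comb _ mf qf.
pose g x := `|f x|; pose h x := g x + f x.
have ig (m : probability Omega R) : m.-integrable setT (EFin \o f) ->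
    m.-integrable setT (EFin \o g).
  by move=> mi; exact: (integrable_norm mi).
have ih (m : probability Omega R) : m.-integrable setT (EFin \o f) ->
    m.-integrable setT (EFin \o h).
  move=> mi; rewrite (_ : EFin \o h = (EFin \o g) \+ (EFin \o f))%E//.
  by apply: integrableD; [exact: measurableT|exact: ig|exact: mi].
have mg : measurable_fun setT g by exact: measurableT_comp.
have mh : measurable_fun setT h by exact: measurable_funD.
have g0 x : 0 <= g x by exact: normr_ge0.
have h0 x : 0 <= h x by rewrite /h /g -lerBlDr sub0r -normrN ler_norm.
have E (m : probability Omega R) : m.-integrable setT (EFin \o f) ->
    \int[m]_x f x = \int[m]_x h x - \int[m]_x g x.
  move=> mi; rewrite -(RintegralB measurableT (ih _ mi) (ig _ mi)).
  by apply: eq_Rintegral => x _; rewrite /h addrAC subrr add0r.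
rewrite E// {1 2}/Rintegral !ge0_Rintegral_conv_comb//;
  [|by move=> i; exact: ig|by move=> i; exact: ih].
by rewrite /= -sumrB; apply: eq_bigr => i _; rewrite E// mulrBr.
Qed.

End convex_hull.

(** Turns a strict gap, possibly with infinite ends, into a gap of positive real length. *)
Lemma ereal_real_between (R : realType) (x y : \bar R) : (x < y)%E ->
  exists r s : R, [/\ (x < r%:E)%E, r < s & (s%:E < y)%E].
Proof.
case: x => [x| |]; case: y => [y| |]//=.
- rewrite lte_fin => xy; exists (x + (y - x) / 3), (x + (y - x) * 2 / 3).
  by rewrite !lte_fin; split; lra.
- by move=> _; exists (x + 1), (x + 2); rewrite lte_fin ltry; split => //; lra.
- by move=> _; exists (y - 2), (y - 1); rewrite lte_fin ltNyr; split => //; lra.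
- by move=> _; exists 0, 1; rewrite ltNyr ltry; split.
Qed.

(** * Uniform tails *)

Section uniform_tails.
Context {d : measure_display} {Omega : measurableType d} {R : realType}.
Variables (T : R) (F : R -> set (set Omega)) (Y : R -> Omega -> R).
Variable Qs : set (probability Omega R).
Hypothesis T0 : 0 < T.
Hypothesis Yrc : rc_adapted_bounded T F Y.
Hypothesis YL1 : in_L1 Qs (Ystar T Y).

Let S w := fine (Ystar T Y w).

Let SE : EFin \o S = Ystar T Y.
Proof.
by apply/funext => w; rewrite /= fineK//; exact: Ystar_fin T0 Yrc w.
Qed.

Lemma measurable_sup_process : measurable_fun setT S.
Proof. by apply/measurable_EFinP; rewrite SE; case: YL1. Qed.

Lemma sup_process_ge0 w : 0 <= S w.
Proof.
apply: le_trans (process_le T F Y T0 Yrc w 0 _); first exact: normr_ge0.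
by rewrite lexx ltW.
Qed.

Lemma integrable_sup_process Q : Qs Q -> Q.-integrable setT (EFin \o S).
Proof.
move=> QQ; rewrite SE; case: YL1 => mY supY; apply/integrableP; split => //.
by apply: le_lt_trans supY; apply: ereal_sup_ubound; exists Q.
Qed.

(** Convergence to [0] makes the suprema eventually finite and at most [eta], so one level [a]
    serves all of [Qs]. *)
Lemma uniform_tail (eta : R) :
  (fun a : R => ereal_sup [set tail_exp Q (Ystar T Y) a | Q in Qs]) @ +oo --> 0%E ->
  0 < eta -> exists2 a, 0 < a & forall Q, Qs Q ->
    \int[Q]_w (S w * \1_[set w | a < S w] w) <= eta.
Proof.
move=> /fine_cvgP[fin cvg] eta0.
have [a [afin a0 ale]] : exists a : R,
    [/\ ereal_sup [set tail_exp Q (Ystar T Y) a | Q in Qs] \is a fin_num, 0 < a &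
     fine (ereal_sup [set tail_exp Q (Ystar T Y) a | Q in Qs]) <= eta].
  move: cvg => /cvgr_le /(_ _ eta0) cvg.
  have : \forall a \near +oo, [/\ ereal_sup [set tail_exp Q (Ystar T Y) a | Q in Qs]
     \is a fin_num, 0 < a &
     fine (ereal_sup [set tail_exp Q (Ystar T Y) a | Q in Qs]) <= eta].
    by near=> a; split; near: a => //; exact: nbhs_pinfty_gt.
  by move=> /filter_ex.
exists a => // Q QQ.
have tE : tail_exp Q (Ystar T Y) a = (\int[Q]_w (S w * \1_[set w | a < S w] w)%:E)%E.
  rewrite /tail_exp; apply: eq_integral => w _; rewrite -SE EFinM.
  by rewrite (_ : [set _ | _] = [set w0 | a < S w0]).
rewrite -lee_fin /Rintegral fineK; last first.
  apply: integrable_fin_num => //.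
  apply: (integrable_tail Q S a measurable_sup_process).
  exact: integrable_sup_process.
rewrite -tE.
apply: le_trans
  (_ : (fine (ereal_sup [set tail_exp Q (Ystar T Y) a | Q in Qs]))%:E <= _)%E.
  by rewrite fineK//; apply: ereal_sup_ubound; exists Q.
by rewrite lee_fin.
Unshelve. all: by end_near.
Qed.

End uniform_tails.

(** * The minimax identity over the convex hull *)

Lemma conv_hull_sub {d : measure_display} {Omega : measurableType d} {R : realType}
  (Qs : set (probability Omega R)) : Qs `<=` conv_hull Qs.
Proof.
move=> Q QQ; exists 1%N, (fun=> 1), (fun=> Q); split => //.
- by rewrite big_ord1.
- by move=> A _; rewrite big_ord1 mul1e.
Qed.

(** If every [x i] exceeded the mean [c], the nonnegative terms [w i * (x i - c)], which sum to
    zero, would force all weights to vanish. *)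
Lemma conv_comb_ge (R : realDomainType) n (w x : 'I_n -> R) :
  (forall i, 0 <= w i) -> \sum_i w i = 1 -> exists i, x i <= \sum_j w j * x j.
Proof.
move=> w0 w1; apply: contrapT => nex.
set c := \sum_j _ in nex.
have lt i : c < x i by rewrite ltNge; apply/negP => h; apply: nex; exists i.
have : \sum_i w i * (x i - c) = 0.
  under eq_bigr do rewrite mulrBr.
  by rewrite sumrB -mulr_suml w1 mul1r subrr.
move=> /eqP; rewrite psumr_eq0 => [/allP z|i _]; last first.
  by rewrite mulr_ge0// subr_ge0 ltW.
have : \sum_i w i = 0.
  rewrite big1// => i _; have := z i (mem_index_enum _).
  by rewrite /= mulf_eq0 subr_eq0 (gt_eqF (lt i)) orbF => /eqP.
by rewrite w1 => /eqP; rewrite oner_eq0.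
Qed.

Theorem theorem2p1 (d : measure_display) (Omega : measurableType d) (R : realType)
  (P : probability Omega R) (T : R) (F : R -> set (set Omega))
  (Qs : set (probability Omega R)) (Y : R -> Omega -> R) :
  0 < T ->
  filtration_usual P T F ->
  Qs !=set0 ->
  (forall Q : probability Omega R, Qs Q -> Q `<< P) ->
  rc_adapted_bounded T F Y ->
  quasi_left_usc P T F Y ->
  (forall t, 0 < t <= T -> atomless_on P (F t)) ->
  in_L1 Qs (Ystar T Y) ->
  (fun a : R => ereal_sup [set tail_exp Q (Ystar T Y) a | Q in Qs]) @ +oo --> 0%E ->
  compact (closure [set muQ Qs A | A in measurable]) ->
  (ereal_sup [set ereal_inf [set EYtau Q Y tau | Q in Qs]
                | tau in stopping_time T F]
   = ereal_sup [set ereal_inf [set EYtau Q Y tau | Q in conv_hull Qs]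
                | tau in stopping_time T F]) /\
  (ereal_sup [set ereal_inf [set EYtau Q Y tau | Q in conv_hull Qs]
                | tau in stopping_time T F]
   = ereal_inf [set ereal_sup [set EYtau Q Y tau | tau in stopping_time T F]
                | Q in conv_hull Qs]).
Proof.
move=> T0 FU Q0 QP Yrc _ atomless YL1 tails cpt.
pose S w := fine (Ystar T Y w).
pose ex (Q : probability Omega R) tau := \int[Q]_w Y (tau w) w.
have mS : measurable_fun setT S := measurable_sup_process T F Y Qs T0 Yrc YL1.
have S0 w : 0 <= S w := sup_process_ge0 T F Y T0 Yrc w.
have iS Q : Qs Q -> Q.-integrable setT (EFin \o S).
  exact: (integrable_sup_process T F Y Qs T0 Yrc YL1).
have mY tau : stopping_time T F tau -> measurable_fun setT (fun w => Y (tau w) w).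
  exact: (measurable_stopped P T F Y T0 FU Yrc).
have iY (Q : probability Omega R) tau : Q.-integrable setT (EFin \o S) -> stopping_time T F tau ->
    Q.-integrable setT (EFin \o (fun w => Y (tau w) w)).
  by move=> iQ stau; exact: (integrable_stopped P T F Y T0 FU Yrc Q tau stau iQ).
have EYE (Q : probability Omega R) tau : Q.-integrable setT (EFin \o S) -> stopping_time T F tau ->
    EYtau Q Y tau = (ex Q tau)%:E.
  move=> iQ stau.
  by rewrite /ex /Rintegral (fineK (integrable_fin_num measurableT (iY _ _ iQ stau))).
have hull Q : conv_hull Qs Q -> exists n (w : 'I_n -> R) (q : 'I_n -> probability Omega R),
    [/\ forall i, 0 <= w i, \sum_i w i = 1, forall i, Qs (q i),
      Q.-integrable setT (EFin \o S) &
      forall tau, stopping_time T F tau -> ex Q tau = \sum_i w i * ex (q i) tau].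
  move=> [n [w [q [w0 w1 Qq Qwq]]]]; exists n, w, q; split => //.
    by apply: (integrable_conv_comb n w q w0 Q Qwq) => // i; exact: iS.
  move=> tau stau; apply: (Rintegral_conv_comb n w q w0 Q Qwq); first exact: mY.
  by move=> i; apply: iY => //; exact: iS.
(* For fixed [tau] the expectation is affine in [Q], so a convex combination is never below all of
   its components. *)
have inf_hull tau : stopping_time T F tau ->
    ereal_inf [set EYtau Q Y tau | Q in Qs]
    = ereal_inf [set EYtau Q Y tau | Q in conv_hull Qs].
  move=> stau; apply/eqP; rewrite eq_le; apply/andP; split; last first.
    by apply: ereal_inf_le_tmp; apply: image_subset; exact: conv_hull_sub.
  apply: le_ereal_inf_tmp => _ [Q /hull[n [w [q [w0 w1 Qq iQ exQ]]]] <-].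
  have [i le_i] := conv_comb_ge _ _ w (fun i => ex (q i) tau) w0 w1.
  apply: ge_ereal_inf; exists (EYtau (q i) Y tau); first by exists (q i).
  by rewrite !EYE//; [rewrite lee_fin exQ|exact: iS].
have sup_inf : ereal_sup [set ereal_inf [set EYtau Q Y tau | Q in Qs]
      | tau in stopping_time T F]
    = ereal_sup [set ereal_inf [set EYtau Q Y tau | Q in conv_hull Qs]
      | tau in stopping_time T F].
  by congr ereal_sup; apply: eq_imagel => tau stau; exact: inf_hull.
split => //; apply/eqP; rewrite eq_le; apply/andP; split.
  apply: ge_ereal_sup => _ [tau stau <-]; apply: le_ereal_inf_tmp => _ [Q hQ <-].
  apply: ge_ereal_inf; exists (EYtau Q Y tau); first by exists Q.
  by apply: ereal_sup_ubound; exists tau.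
rewrite -sup_inf leNgt; apply/negP => /ereal_real_between[c' [c [Lc' c'c cI]]].
(* Error budget: [e0 / 4] for the minimax step, [2 * a * (e0 / (8 * a)) = e0 / 4] for total
   variation and [2 * (e0 / 8)] for the tails, in all less than [e0]. *)
pose e0 := c - c'.
have e00 : 0 < e0 by rewrite subr_gt0.
have [|a a0 ta] := uniform_tail T F Y Qs T0 Yrc YL1 (e0 / 8) tails.
  by rewrite divr_gt0.
have ea0 : 0 < e0 / (8 * a) by rewrite divr_gt0// mulr_gt0.
have [n [q [Qq net]]] := finite_tv_net Qs _ Q0 ea0 cpt.
have abscont eta : 0 < eta -> exists2 delta, 0 < delta &
    forall i B, measurable B -> fine (q i B) <= delta ->
    \int[q i]_(x in B) S x <= eta.
  move=> eta0; have eta2 : 0 < eta / 2 by rewrite divr_gt0.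
  have [b b0 tb] := uniform_tail T F Y Qs T0 Yrc YL1 _ tails eta2.
  (* The bounded part then costs [b * delta = eta / 2], and the tail above [b] the other half. *)
  exists (eta / (2 * b)); first by rewrite divr_gt0// mulr_gt0.
  move=> i B mB qB.
  apply: le_trans (Rintegral_le_tail _ _ _ _ mS S0 (ltW b0) (iS _ (Qq i)) mB) _.
  have h1 := tb _ (Qq i).
  have : b * fine (q i B) <= b * (eta / (2 * b)) by rewrite ler_wpM2l// ltW.
  rewrite (_ : b * (eta / (2 * b)) = eta / 2); last by field; rewrite gt_eqF.
  move: h1; rewrite -/(S _); lra.
have e40 : 0 < e0 / 4 by rewrite divr_gt0.
have [||||tau stau tauP] := @approx_minimax R n (Omega -> R) (stopping_time T F)
    (fun tau i => ex (q i) tau) (\sum_i \int[q i]_x S x) c _ _ _ _ _ e40.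
- exists (fun=> 0); split; first by move=> w; rewrite lexx ltW.
  move=> t /andP[t0 tT]; have sF := filtration_sigma P T F FU t ltac:(by rewrite t0).
  rewrite (_ : [set _ | _] = ~` set0); first exact: (subalgC _ sF _ (subalg0 _ sF)).
  by rewrite setC0 -subTset => w _ /=.
- move=> tau i stau; have iq := iY _ _ (iS _ (Qq i)) stau.
  apply: le_trans (le_normr_Rintegral measurableT iq) _.
  apply: (@le_trans _ _ (\int[q i]_x S x)).
    apply: le_Rintegral => //; first exact: (integrable_norm iq).
      exact: iS.
    by move=> w _; apply: (process_le T F Y T0 Yrc); case: stau.
  rewrite (bigD1 i)//= lerDl sumr_ge0// => j _.
  exact: Rintegral_ge0.
- move=> tau1 tau2 t e st1 st2 t01 epos.
  exact: (stopping_mixture P T F Y T0 FU Yrc n q (fun i => QP _ (Qq i)) atomless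
    (fun i => iS _ (Qq i)) abscont).
(* Weights define a mixture [Q] in the convex hull. Its optimal stopping value exceeds [c], so some
   [tau] does, and the weighted sum is the expectation under [Q]. *)
- move=> l l0 l1; have [Q Qlq] := conv_comb_probability n l q l0 l1.
  have hQ : conv_hull Qs Q by exists n, l, q; split.
  have iQ : Q.-integrable setT (EFin \o S).
    by apply: (integrable_conv_comb n l q l0 Q) => // i; exact: iS.
  have : (c%:E < ereal_sup [set EYtau Q Y tau | tau in stopping_time T F])%E.
    by apply: lt_le_trans cI _; apply: ereal_inf_lbound; exists Q.
  move=> /ereal_sup_gt[_ [tau stau <-]]; rewrite EYE// lte_fin => /ltW cQ.
  exists tau => //; apply: le_trans cQ _.
  rewrite [leLHS](Rintegral_conv_comb n l q l0 Q)//; first exact: mY.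
  by move=> i; apply: iY => //; exact: iS.
have : (c'%:E <= ereal_sup [set ereal_inf [set EYtau Q Y tau | Q in Qs]
    | tau in stopping_time T F])%E.
  apply: le_ereal_sup_tmp; exists (ereal_inf [set EYtau Q Y tau | Q in Qs]).
    by exists tau.
  apply: le_ereal_inf_tmp => _ [Q QQ <-]; rewrite EYE//; last exact: iS.
  rewrite lee_fin; have [i near_i] := net _ QQ.
  have close A : measurable A -> fine (q i A) <= fine (Q A) + e0 / (8 * a).
    by move=> /near_i; rewrite ler_norml; lra.
  have := Rintegral_tv_tail_le (q i) Q _ S a _ _ (mY _ stau) mS _ (ltW a0) (ltW ea0)
    (iS _ (Qq i)) (iS _ QQ) (ta _ (Qq i)) (ta _ QQ) close.
  rewrite (_ : 2 * a * (e0 / (8 * a)) = e0 / 4); last by field; rewrite gt_eqF.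
  have := tauP i; rewrite /ex /e0 => h1 h2.
  have := h2 (fun w => process_le T F Y T0 Yrc w (tau w) (stau.1 w)).
  rewrite /e0 in h1 *; lra.
by rewrite leNgt Lc'.
Qed.
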